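(* Let $d,m$ be positive integers. Let $\mathcal{B}_1,\dots,\mathcal{B}_{2d}$ be finite families of axis-parallel boxes in $\mathbb{R}^d$. Let $S_1,\dots,S_m\subseteq\mathbb{R}^d$ be discrete sets and $n_1,\dots,n_m$ positive integers. Suppose that for every choice of $B_i\in\mathcal{B}_i$ for each $i\in[2d]$ we have $\big|\bigcap_{i=1}^{2d}B_i\cap S_j\big|\ge n_j$ for each $j\in[m]$. Then there exists an index $l\in[2d]$ such that $\big|\bigcap\mathcal{B}_l\cap S_j\big|\ge n_j$ for all $j\in[m]$.
   Context: An axis-parallel box in $\mathbb{R}^d$ is a set of the form $[a_1,b_1]\times\cdots\times[a_d,b_d]$ with $a_i\le b_i$ real numbers. $[k]=\{1,\dots,k\}$. *)

(* Defs.v *)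
From mathcomp Require Import all_boot all_order all_algebra.
From mathcomp Require Import all_classical all_reals all_analysis.

Set Implicit Arguments.
Unset Strict Implicit.
Unset Printing Implicit Defensive.

Import Order.TTheory GRing.Theory Num.Theory.
Import numFieldNormedType.Exports.

Local Open Scope classical_set_scope.
Local Open Scope ring_scope.

Definition is_box (R : realType) (d : nat) (B : set 'rV[R]_d) : Prop :=
  exists a b : 'rV[R]_d,
    (forall i, a 0 i <= b 0 i) /\
    B = [set x | forall i, a 0 i <= x 0 i <= b 0 i].

(* Discrete in the subspace topology; S need not be closed. *)
Definition discrete_set (T : topologicalType) (S : set T) : Prop :=
  S `<=` isolated S.

(* |A| >= n; holds for every n when A is infinite. *)
Definition at_least (T : Type) (n : nat) (A : set T) : Prop :=
  (`I_n #<= A)%card.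

(* Main.v *)
(** Write a box as [2d] one-sided constraints, one per face.  Treat the faces
    one after another: for each face pick, among the families not yet used, one
    containing the member that is tightest at that face, and choose this member
    in that family.  The family [l] picked last was still available at every
    step, so at each face some chosen box is at least as tight as every box of
    [l]; hence the chosen boxes intersect inside the intersection of [l]. *)

Require Import Defs.
From mathcomp Require Import all_boot all_order all_algebra.
From mathcomp Require Import all_classical all_reals all_analysis.

Set Implicit Arguments.
Unset Strict Implicit.
Unset Printing Implicit Defensive.

Import Order.TTheory GRing.Theory Num.Theory.
Import numFieldNormedType.Exports.

Local Open Scope classical_set_scope.
Local Open Scope ring_scope.

(** Induction on the list: [t] takes an index maximising [M t] over [A], which is then deleted; [l]
    is drawn from what remains, so it never beats a maximiser. *)
Lemma greedy_assignment (disp : Order.disp_t) (K : orderType disp)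
    (T : eqType) (I : finType) (M : T -> I -> K) (t : T) (ts : seq T)
    (A : {set I}) :
  (size ts < #|A|)%N ->
  exists l, l \in A /\ exists g : I -> T,
    forall s, s \in t :: ts -> exists i, i \in A /\ g i = s /\ (M s l <= M s i)%O.
Proof.
elim: ts t A => [|t' ts IH] t A /= ltA.
  have [l lA] := card_gt0P ltA.
  (* The last face is served by [l] itself, so [#|A|] may equal the number of faces. Indices never
     picked get this face by default. *)
  exists l; split => //; exists (fun=> t) => s; rewrite inE => /eqP ->.
  by exists l.
have [i0 i0A] : exists i, i \in A by apply/card_gt0P; apply: leq_trans ltA.
case: (arg_maxP (M t) i0A) => i1 memi1 maxi1.
have i1A : i1 \in A by [].
have [|l [lA' [g gP]]] := IH t' (A :\ i1)%SET.
  by move: ltA; rewrite (cardsD1 i1 A) i1A.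
have /setD1P[_ lA] := lA'.
exists l; split => //; exists (fun i => if i == i1 then t else g i) => s.
rewrite in_cons => /orP[/eqP ->|/gP[i [/setD1P[ni iA] [gi le_i]]]].
  by exists i1; rewrite eqxx; split => //; split => //; exact: maxi1.
by exists i; rewrite (negbTE ni).
Qed.

Lemma finite_set_argmax (disp : Order.disp_t) (K : orderType disp)
    (T : choiceType) (A : set T) (f : T -> K) :
  finite_set A -> A !=set0 ->
  exists2 x, A x & forall y, A y -> (f y <= f x)%O.
Proof.
move=> /finite_seqP[s ->] [x0 x0s].
elim: s x0 x0s => [//|a s IH] x0 _.
case: s IH => [_|b s /(_ b)[|x xs xmax]]; first 2 last.
- have [le_ax|lt_xa] := leP (f a) (f x).
    exists x => [|y]; rewrite /= in_cons ?xs ?orbT //.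
    by move=> /orP[/eqP ->//|]; exact: xmax.
  exists a => [|y]; rewrite /= in_cons ?eqxx //.
  by move=> /orP[/eqP ->//|/xmax ?]; exact: le_trans (ltW lt_xa).
- by exists a => [|y]; rewrite /= inE // => /eqP ->.
- exact: mem_head.
Qed.

(** The greedy choice only needs sets cut out by thresholds on a fixed family of functions [h t],
    with at least as many families as functions. *)
Lemma colorful_subset_bigcap (disp : Order.disp_t) (K : orderType disp)
    (X : Type) (T I : finType) (t0 : T) (h : T -> X -> K)
    (B : I -> set (set X)) :
  (#|T| <= #|I|)%N ->
  (forall i, finite_set (B i)) -> (forall i, B i !=set0) ->
  (forall i b, B i b ->
     exists u : T -> K, b = [set x | forall t, (u t <= h t x)%O]) ->
  exists C : I -> set X, (forall i, B i (C i)) /\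
    exists l, \bigcap_(i in [set: I]) C i `<=` \bigcap_(b in B l) b.
Proof.
move=> leTI finB B0 halfB.
have /choice[u uP] : forall b : set X, exists u : T -> K,
    forall i, B i b -> b = [set x | forall t, (u t <= h t x)%O].
  move=> b; have [[i /halfB[u bE]]|nB] := pselect (exists i, B i b).
    by exists u.
  (* For [b] in no family any [u] will do; one is borrowed from a member of some family, which
     exists since [t0] forces [I] to be nonempty. *)
  have [i|] := pickP (@predT I); last first.
    by move=> I0; move: leTI; rewrite (eq_card0 I0) leqn0 (cardD1 t0).
  have [c /halfB[u _]] := B0 i.
  by exists u => j Bj; case: nB; exists j.
have /choice[c cP] : forall it : I * T, exists b, B it.1 b /\
    forall b', B it.1 b' -> (u b' it.2 <= u b it.2)%O.
  move=> [i t].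
  have [b Bb bmax] := finite_set_argmax (fun b => u b t) (finB i) (B0 i).
  by exists b.
(* The tightest threshold at [t] within family [i]. *)
pose M t i := u (c (i, t)) t.
have [l [g gP]] : exists l, exists g : I -> T,
    forall s, exists i, g i = s /\ (M s l <= M s i)%O.
  case ET: (enum T) => [|t ts].
    by have := mem_enum T t0; rewrite ET.
  have [|l [_ [g gP]]] := @greedy_assignment _ _ _ _ M t ts [set: I]%SET.
    by rewrite cardsT (leq_trans _ leTI)// cardE ET.
  exists l, g => s; have [|i [_ giP]] := gP s; first by rewrite -ET mem_enum.
  by exists i.
exists (fun i => c (i, g i)); split => [i|]; first by have [] := cP (i, g i).
exists l => x Cx b Bb; rewrite (uP b l Bb) => t /=.
(* The chain is [u b t <= M t l <= M t i <= h t x], where [i] is the index assigned to [t]. *)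
have [i [gi le_li]] := gP t.
have [Bc _] := cP (i, t); have [_ cmax] := cP (l, t).
have := Cx i Logic.I; rewrite /= gi (uP _ _ Bc) => /(_ t).
by apply: le_trans; apply: le_trans le_li; exact: cmax.
Qed.

(** The sign turns upper bounds on a coordinate into lower bounds, so both kinds of face are
    thresholds of one form. *)
Definition face_coord (R : realType) (d : nat) (f : 'I_d * bool)
  (x : 'rV[R]_d) : R := if f.2 then x 0 f.1 else - x 0 f.1.

Lemma box_faces (R : realType) (d : nat) (b : set 'rV[R]_d) :
  is_box b -> exists u : 'I_d * bool -> R,
    b = [set x | forall f, u f <= face_coord f x].
Proof.
move=> [lo [hi [_ ->]]].
exists (fun f => if f.2 then lo 0 f.1 else - hi 0 f.1).
apply/seteqP; split => x /= xP.
  by move=> [i []]; rewrite /face_coord /= ?lerN2; have /andP[] := xP i.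
move=> i; have := xP (i, true); have := xP (i, false).
by rewrite /face_coord /= lerN2 => -> ->.
Qed.

Theorem theorem2p8 (R : realType) (d m : nat) (d_gt0 : (0 < d)%N) (m_gt0 : (0 < m)%N)
    (B : 'I_(2 * d) -> set (set 'rV[R]_d))
    (B_finite : forall i, finite_set (B i))
    (B_nonempty : forall i, B i !=set0)
    (B_box : forall i b, B i b -> is_box b)
    (S : 'I_m -> set 'rV[R]_d) (S_discrete : forall j, discrete_set (S j))
    (n : 'I_m -> nat) (n_gt0 : forall j, (0 < n j)%N)
    (B_choice : forall C : 'I_(2 * d) -> set 'rV[R]_d, (forall i, B i (C i)) ->
      forall j, at_least (n j) ((\bigcap_(i in [set: 'I_(2 * d)]) C i) `&` S j)) :
  exists l : 'I_(2 * d),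
    forall j, at_least (n j) ((\bigcap_(b in B l) b) `&` S j).
Proof.
have [||C [BC [l CB]]] := @colorful_subset_bigcap _ R _ ('I_d * bool)%type 'I_(2 * d)
    (Ordinal d_gt0, true) (@face_coord R d) B _ B_finite B_nonempty.
- by rewrite card_prod !card_ord card_bool mulnC.
- by move=> i b /B_box /box_faces.
exists l => j; apply: card_le_trans (B_choice C BC j) _.
by apply: subset_card_le; exact: setSI.
Qed.
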